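(* Let $k$ be a field of characteristic $p>0$ and let $H$ be a finite-dimensional pointed rank one Hopf algebra over $k$, generated as an algebra by $H_1$, of third type, with skew point $a$ and $x\in P_{a,1}\setminus H_0$ satisfying $axa^{-1}=x+(a-1)$. Then $x^p\in H_1$ and $p$ is the degree of $x$. Moreover $x^p=x+\alpha(a^p-1)$ for some $\alpha\in k$.
   Context: For a finite-dimensional Hopf algebra $H$ over $k$: $G(H)$ is the group of group-like elements; the coradical $H_0$ is the sum of the simple subcoalgebras; $H_1=\Delta^{-1}(H\otimes H_0+H_0\otimes H)$. $H$ is pointed if all simple subcoalgebras are one-dimensional, so that $H_0=kG(H)$. For $g,h\in G(H)$, $P_{g,h}=\{c\in H:\Delta(c)=c\otimes g+h\otimes c\}$. An element $a\in G(H)$ is a skew point if $P_{a,1}\setminus H_0\neq\emptyset$. A pointed $H$ has rank $t$ if $\dim_k k\otimes_{H_0}H_1=t+1$ ($k$ trivial via the counit). A pointed rank one Hopf algebra has exactly one skew point $a$, and it is central in $G(H)$. $H$ is of third type if $a\ne1$ and there is $x\in P_{a,1}\setminus H_0$ with $axa^{-1}=x+(a-1)$. The degree of $x\in H_1\setminus H_0$ is the smallest integer $n$ with $x^n\in\sum_{i=0}^{n-1}H_0x^i$. *)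

(* Defs.v *)
From HB Require Import structures.
From mathcomp Require Import all_boot all_order all_algebra all_field.
From mathcomp Require Import boolp.

Set Implicit Arguments.
Unset Strict Implicit.
Unset Printing Implicit Defensive.

Import GRing.Theory.
Local Open Scope ring_scope.

(* The linear span of an arbitrary, possibly infinite, set of vectors of a
   finite-dimensional space: the smallest subspace containing it. *)
Section Vspan.
Variables (k : fieldType) (V : vectType k).

Lemma vspan_exists (P : V -> Prop) :
  exists W : {vspace V}, (forall x, P x -> x \in W) /\
    (forall W' : {vspace V}, (forall x, P x -> x \in W') -> (W <= W')%VS).
Proof.
pose Q (n : nat) := `[< exists W : {vspace V}, \dim W = n /\
  forall W' : {vspace V}, (forall x, P x -> x \in W') -> (W <= W')%VS >].
have Q0 : exists n, Q n.
  exists 0%N; apply/asboolP; exists 0%VS; rewrite dimv0; split=> // W' _.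
  exact: sub0v.
have Qb n : Q n -> (n <= \dim {:V})%N.
  by move=> /asboolP[W [<- _]]; exact/dimvS/subvf.
have [n /asboolP[W [dW sW]] max_n] := ex_maxnP Q0 Qb.
exists W; split=> // x Px; apply/negPn/negP => xW.
have lt_n : (n < \dim (W + <[x]>))%N.
  rewrite -dW ltnNge; apply/negP => le_d; move/negP: xW; apply.
  have /eqP-> : W == (W + <[x]>)%VS by rewrite eqEdim addvSl le_d.
  by rewrite memvE addvSr.
suff /max_n : Q (\dim (W + <[x]>)) by rewrite leqNgt lt_n.
apply/asboolP; exists (W + <[x]>)%VS; split=> // W' PW'.
by rewrite subv_add sW // -memvE PW'.
Qed.

Definition vspan (P : V -> Prop) : {vspace V} := sval (cid (vspan_exists P)).

Lemma mem_vspan (P : V -> Prop) x : P x -> x \in vspan P.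
Proof. by rewrite /vspan; case: cid => W [] /= + _; apply. Qed.

Lemma vspan_min (P : V -> Prop) (W : {vspace V}) :
  (forall x, P x -> x \in W) -> (vspan P <= W)%VS.
Proof. by rewrite /vspan; case: cid => W' [] /= _; apply. Qed.

End Vspan.

(* Model of the tensor product U (x) V of finite-dimensional spaces: matrices
   of coordinates with respect to the standard bases of U and V. *)
Notation tensor k U V := 'M[k]_(\dim (fullv : {vspace U}),
                                \dim (fullv : {vspace V})).

Section Tensor.
Variable k : fieldType.
Implicit Types U V W : vectType k.

Definition tens U V (u : U) (v : V) : tensor k U V :=
  \matrix_(i, j) (coord (vbasis fullv) i u * coord (vbasis fullv) j v).

(* The linear map induced on U (x) V by a bilinear map; see [tlift_tens]. *)
Definition tlift U V W (B : U -> V -> W) (t : tensor k U V) : W :=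
  \sum_i \sum_j t i j *: B (vbasis fullv)`_i (vbasis fullv)`_j.

Lemma tlift_tens U V W (B : U -> V -> W) :
  (forall v, linear (B^~ v)) -> (forall u, linear (B u)) ->
  forall u v, tlift B (tens u v) = B u v.
Proof.
move=> Bl Br u v; rewrite /tlift.
have BlE w (c : 'I_(\dim {:U}) -> k) (f : 'I_(\dim {:U}) -> U) :
    B (\sum_i c i *: f i) w = \sum_i c i *: B (f i) w.
  have B0 : B 0 w = 0.
    by have := Bl w (-1) 0 0; rewrite scaler0 addr0 scaleN1r addNr.
  elim/big_rec2: _ => [//|i y1 y2 _ <-]; exact: Bl.
have BrE w (c : 'I_(\dim {:V}) -> k) (f : 'I_(\dim {:V}) -> V) :
    B w (\sum_i c i *: f i) = \sum_i c i *: B w (f i).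
  have B0 : B w 0 = 0.
    by have := Br w (-1) 0 0; rewrite scaler0 addr0 scaleN1r addNr.
  elim/big_rec2: _ => [//|i y1 y2 _ <-]; exact: Br.
rewrite {2}(coord_vbasis (memvf u)) BlE; apply: eq_bigr => i _.
rewrite {2}(coord_vbasis (memvf v)) BrE scaler_sumr.
by apply: eq_bigr => j _; rewrite mxE scalerA.
Qed.

Definition tens_space U V (A : {vspace U}) (B : {vspace V}) :
  {vspace tensor k U V} :=
  vspan (fun t => exists u v, [/\ u \in A, v \in B & t = tens u v]).

(* The associator (U (x) V) (x) W -> U (x) (V (x) W). *)
Definition tassoc U V W (t : tensor k (tensor k U V) W) :
  tensor k U (tensor k V W) :=
  tlift (fun s w => tlift (fun u v => tens u (tens v w)) s) t.

Definition tens_mul (A : falgType k) (s t : tensor k A A) : tensor k A A :=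
  tlift (fun u v => tlift (fun u' v' => tens (u * u') (v * v')) t) s.

End Tensor.

(* [falgType k] provides a finite-dimensional associative unital algebra. *)
Record hopfAlgebra (k : fieldType) := HopfAlgebra {
  hopf_alg :> falgType k;
  comul : 'Hom(hopf_alg, tensor k hopf_alg hopf_alg);
  counit : 'Hom(hopf_alg, k^o);
  antipode : 'End(hopf_alg);
  comulA : forall x,
    tassoc (tlift (fun u v => tens (comul u) v) (comul x)) =
    tlift (fun u v => tens u (comul v)) (comul x);
  counitl : forall x, tlift (fun u v => (counit u : k) *: v) (comul x) = x;
  counitr : forall x, tlift (fun u v => (counit v : k) *: u) (comul x) = x;
  comul1 : comul 1 = tens 1 1;
  comulM : forall x y, comul (x * y) = tens_mul (comul x) (comul y);
  counit1 : counit 1 = 1;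
  counitM : forall x y, counit (x * y) = counit x * counit y;
  antipodel : forall x, tlift (fun u v => antipode u * v) (comul x) =
    (counit x : k) *: 1;
  antipoder : forall x, tlift (fun u v => u * antipode v) (comul x) =
    (counit x : k) *: 1
}.

Section HopfTheory.
Variables (k : fieldType) (H : hopfAlgebra k).
Implicit Types (g h a c x : H) (C D : {vspace H}).

Definition grouplike g : Prop := comul H g = tens g g /\ counit H g = 1.

Definition subcoalgebra C : Prop := (comul H @: C <= tens_space C C)%VS.

Definition simple_subcoalgebra C : Prop :=
  [/\ subcoalgebra C, C != 0%VS &
      forall D, subcoalgebra D -> (D <= C)%VS -> D = 0%VS \/ D = C].

Definition coradical : {vspace H} :=
  vspan (fun x => exists2 C, simple_subcoalgebra C & x \in C).

Definition coradical1 : {vspace H} :=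
  (comul H @^-1: (tens_space fullv coradical + tens_space coradical fullv))%VS.

Definition pointed : Prop := forall C, simple_subcoalgebra C -> \dim C = 1%N.

Definition skew_primitive g h c : Prop :=
  comul H c = tens c g + tens h c.

Definition skew_point a : Prop :=
  grouplike a /\ exists2 x, skew_primitive a 1 x & x \notin coradical.

(* The kernel of k (x)_k H_1 -> k (x)_{H_0} H_1, where H_0 acts on k through
   the counit. *)
Definition balancing : {vspace tensor k k^o H} :=
  vspan (fun t => exists (c : k^o) h m, [/\ h \in coradical, m \in coradical1 &
    t = tens (c * counit H h) m - tens c (h * m)]).

(* dim (k (x)_{H_0} H_1) = t + 1; the left-hand side is the dimension of a
   complement of the balancing relations in k (x)_k H_1.  The notion is only
   meaningful when H is pointed, so that H_0 is a subalgebra and H_1 a left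
   H_0-module. *)
Definition has_rank (t : nat) : Prop :=
  \dim (tens_space (fullv : {vspace k^o}) coradical1 :\: balancing)%VS = t.+1.

Definition generated_by_coradical1 : Prop := agenv coradical1 = fullv.

(* [a] stands for the skew point of H, which is unique in rank one. *)
Definition third_type a : Prop :=
  a != 1 /\ exists x, [/\ skew_primitive a 1 x, x \notin coradical &
                          a * x * a^-1 = x + (a - 1)].

Definition reduces_at x (n : nat) : Prop :=
  x ^+ n \in (\sum_(i < n) coradical * <[x ^+ i]>)%VS.

Definition is_degree x (n : nat) : Prop :=
  reduces_at x n /\ forall m, reduces_at x m -> (n <= m)%N.

End HopfTheory.

Arguments coradical {k} H.
Arguments coradical1 {k} H.
Arguments pointed {k} H.
Arguments has_rank {k} H t.
Arguments generated_by_coradical1 {k} H.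

(* Main.v *)
From HB Require Import structures.
Require Import Defs.
From mathcomp Require Import all_boot all_order all_algebra all_field.
From mathcomp Require Import boolp.

(** The proof runs through the falling factorials x(n) = x (x-1) ... (x-n+1)
    instead of the powers of x.  The relation a x a^-1 = x + (a-1) says that
    x a = a x + a - a^2, and with it the comultiplication satisfies a
    Chu-Vandermonde identity with ordinary binomial coefficients
    ([comul_falling]):
      Delta x(n) = sum_j C(n,j) x(j) (x) a^j x(n-j).
    In characteristic p the inner coefficients C(p,j) vanish and
    x(p) = x^p - x, so y := x^p - x lies in P_{a^p,1}
    ([skew_primitive_falling]).

    Moreover a^p <> a: the relation makes a^p commute with x, whereas a
    commutes with x only if a = a^2.  If y were not in H_0, then a and a^p
    would be two distinct skew points, and 1, x, y would be independent in
    k (x)_{H_0} H_1, against rank one ([rank_one_skew_point]).  To see the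
    independence, use that H_1 / H_0 is a left H_0-Hopf module; its projection
    onto coinvariants, m |-> S(m_{-1}) m_0, kills H_0^+ H_1 and fixes x and y,
    while x and y are independent modulo H_0 because grouplikes are linearly
    independent.  So y is in H_0, and an element of P_{a^p,1} in H_0 is a
    multiple of a^p - 1 ([skew_primitive_coradical]).  This is the formula for
    x^p; it gives x^p in H_1 and bounds the degree by p.

    For the lower bound suppose x^(m+1) is in S_(m+1) = sum_{i<=m} H_0 x^i with
    m+1 < p, while x^m is not in S_m.  Let l be a linear form that vanishes on
    S_m and takes the value 1 at x^m.  Then l (x) id maps Delta(S_(m+1)) into
    H_0, but it maps Delta(x^(m+1)) to (m+1) a^m x modulo H_0; as m+1 is
    invertible in k, this would put x in H_0 ([expx_notin_xspan]). *)

Set Implicit Arguments.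
Unset Strict Implicit.
Unset Printing Implicit Defensive.

Import GRing.Theory.
Local Open Scope ring_scope.

(** * Spans and linear forms *)

Section Spans.
Variable k : fieldType.
Implicit Types V : vectType k.

(** Dimension is bounded, so subspaces with a given property have a maximal
    member; this replaces the choice of spanning families below. *)
Lemma max_subspace V (Q : {vspace V} -> Prop) (U0 : {vspace V}) :
  Q U0 ->
  exists2 U : {vspace V}, Q U & forall v, Q (U + <[v]>)%VS -> v \in U.
Proof.
move=> QU0; pose q n := `[< exists2 U : {vspace V}, Q U & \dim U = n >].
have q0 : exists n, q n by exists (\dim U0); apply/asboolP; exists U0.
have qb n : q n -> (n <= \dim {:V})%N.
  by move=> /asboolP[U _ <-]; apply/dimvS/subvf.
have [_ /asboolP[U QU <-] maxU] := ex_maxnP q0 qb; exists U => // v QUv.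
have le_dim : (\dim (U + <[v]>) <= \dim U)%N.
  by apply/maxU/asboolP; exists (U + <[v]>)%VS.
have /eqP-> : U == (U + <[v]>)%VS by rewrite eqEdim addvSl.
by rewrite memvE addvSr.
Qed.

(** A maximal subspace contained in Q absorbs every vector of P. *)
Lemma vspan_ind V (P Q : V -> Prop) :
  Q 0 -> (forall c u v, Q u -> Q v -> Q (c *: u + v)) ->
  (forall v, P v -> Q v) -> forall v, v \in vspan P -> Q v.
Proof.
move=> Q0 Qlin PQ.
pose QS (D : {vspace V}) := forall u, u \in D -> Q u.
have [|U QU maxU] := @max_subspace V QS 0%VS.
  by move=> u; rewrite memv0 => /eqP->.
suff PU v : P v -> v \in U by move=> v /(subvP (vspan_min PU)); exact: QU.
move=> Pv.
apply: maxU => _ /memv_addP[u uU [_ /vlineP[c ->] ->]].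
by rewrite addrC; apply: Qlin; [exact: PQ | exact: QU].
Qed.

(** Compose the projection along W with a coordinate on the line of the image
    of v. *)
Lemma functional_separation (V : vectType k) (W : {vspace V}) v :
  v \notin W ->
  exists2 l : 'Hom(V, k^o), l v = 1 & forall w, w \in W -> l w = 0.
Proof.
move=> vW; pose q : 'End(V) := (\1 - projv W)%VF.
have qE u : q u = u - projv W u by rewrite !lfun_simp.
have qv0 : q v != 0.
  rewrite qE subr_eq0; apply: contraNneq vW => ->; exact: memv_proj.
pose X := [tuple q v]; have fX : free X by rewrite seq1_free.
exists (linfun (coord X ord0 : V -> k^o) \o q)%VF => [|w wW];
  rewrite comp_lfunE lfunE /=.
  by rewrite -[q v]/(X`_(@ord0 0)) coord_free.
by rewrite qE projv_id // subrr linear0.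
Qed.

(** Linear independence modulo B, read off from the dimension of a complement
    of B: the form in which the rank is defined. *)
Lemma dim_diffv_ge V n (X : n.-tuple V) (D B : {vspace V}) :
  (forall i : 'I_n, X`_i \in D) ->
  (forall c : 'I_n -> k, \sum_i c i *: X`_i \in B -> forall i, c i = 0) ->
  (n <= \dim (D :\: B))%N.
Proof.
move=> XD Xindep.
have XB : (<<X>> :&: (D :&: B) = 0)%VS.
  apply/eqP; rewrite -subv0; apply/subvP => v /memv_capP[/coord_span vE].
  case/memv_capP => _ vB; rewrite memv0 vE big1 // => i _.
  by rewrite (Xindep (coord X ^~ v)) ?scale0r // -vE.
have fX : free X.
  by apply/freeP => c cX i; apply: Xindep; rewrite cX mem0v.
rewrite -(leq_add2l (\dim (D :&: B))) dimv_cap_compl addnC.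
rewrite -{1}(size_tuple X) -(eqP fX) -dimv_disjoint_sum //.
apply: dimvS; rewrite subv_add capvSl andbT.
by apply/span_subvP => v /tnthP[i ->]; rewrite (tnth_nth 0).
Qed.

End Spans.

(** * Tensor calculus *)

Section TensorCalculus.
Variable k : fieldType.
Implicit Types U V W : vectType k.

Fact tlift_is_linear U V W (B : U -> V -> W) : linear (tlift B).
Proof.
move=> c s t; rewrite /tlift scaler_sumr -big_split; apply: eq_bigr => i _.
rewrite scaler_sumr -big_split; apply: eq_bigr => j _.
by rewrite !mxE scalerDl scalerA.
Qed.

HB.instance Definition _ U V W (B : U -> V -> W) :=
  GRing.isLinear.Build k (tensor k U V) W _ (tlift B) (tlift_is_linear B).

Lemma tens_linl U V (v : V) : linear (fun u : U => tens u v).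
Proof.
by move=> c s t; apply/matrixP=> i j; rewrite !mxE linearP mulrDl mulrA.
Qed.

Lemma tens_linr U V (u : U) : linear (tens u : V -> _).
Proof.
by move=> c s t; apply/matrixP=> i j; rewrite !mxE linearP mulrDr mulrCA.
Qed.

HB.instance Definition _ U V (u : U) :=
  GRing.isLinear.Build k V (tensor k U V) _ (tens u) (tens_linr u).

Lemma tensDl U V (u u' : U) (v : V) : tens (u + u') v = tens u v + tens u' v.
Proof. by have := tens_linl v 1 u u'; rewrite !scale1r. Qed.

Lemma tens0l U V (v : V) : tens (0 : U) v = 0.
Proof. by apply: (addrI (tens 0 v)); rewrite -tensDl !addr0. Qed.

Lemma tensZl U V c (u : U) (v : V) : tens (c *: u) v = c *: tens u v.
Proof. by have := tens_linl v c u 0; rewrite tens0l !addr0. Qed.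

Lemma tensZr U V c (u : U) (v : V) : tens u (c *: v) = c *: tens u v.
Proof. exact: linearZ. Qed.

Lemma tlift_tensK U V (t : tensor k U V) : tlift (@tens k U V) t = t.
Proof.
apply/matrixP => a b; rewrite /tlift summxE (bigD1 a) //= summxE (bigD1 b) //=.
rewrite !mxE !coord_free ?(basis_free (vbasisP _)) // !eqxx !mulr1.
rewrite !big1 ?addr0 // => [i ia | j jb].
  rewrite summxE big1 // => j _.
  rewrite !mxE !coord_free ?(basis_free (vbasisP _)) //.
  by rewrite (negPf ia) mul0r mulr0.
rewrite !mxE !coord_free ?(basis_free (vbasisP _)) //.
by rewrite (negPf jb) !mulr0.
Qed.

(** The universal property of the tensor product: a linear map is determined
    by its values on pure tensors. *)
Lemma linear_tlift U V W (f : {linear tensor k U V -> W}) t :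
  f t = tlift (fun u v => f (tens u v)) t.
Proof.
rewrite -{1}(tlift_tensK t) linear_sum; apply: eq_bigr => i _.
by rewrite linear_sum; apply: eq_bigr => j _; rewrite linearZ.
Qed.

Lemma eq_tlift U V W (B B' : U -> V -> W) t :
  (forall u v, B u v = B' u v) -> tlift B t = tlift B' t.
Proof.
by move=> eB; apply: eq_bigr => i _; apply: eq_bigr => j _; rewrite eB.
Qed.

Lemma tlift_linfun U V W c (B B' B'' : U -> V -> W) t :
  (forall u v, B u v = c *: B' u v + B'' u v) ->
  tlift B t = c *: tlift B' t + tlift B'' t.
Proof.
move=> eB; rewrite /tlift scaler_sumr -big_split; apply: eq_bigr => i _.
rewrite scaler_sumr -big_split; apply: eq_bigr => j _.
by rewrite eB scalerDr !scalerA mulrC.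
Qed.

Lemma tensor_ext U V W (f g : tensor k U V -> W) :
  linear f -> linear g -> (forall u v, f (tens u v) = g (tens u v)) -> f =1 g.
Proof.
move=> lf lg efg t.
pose f' : {linear tensor k U V -> W} :=
  HB.pack f (GRing.isLinear.Build _ _ _ _ f lf).
pose g' : {linear tensor k U V -> W} :=
  HB.pack g (GRing.isLinear.Build _ _ _ _ g lg).
have fE : f t = tlift (fun u v => f (tens u v)) t := linear_tlift f' t.
have gE : g t = tlift (fun u v => g (tens u v)) t := linear_tlift g' t.
by rewrite fE gE; apply: eq_tlift.
Qed.

Lemma mem_tens_space U V (A : {vspace U}) (B : {vspace V}) u v :
  u \in A -> v \in B -> tens u v \in tens_space A B.
Proof. by move=> uA vB; apply: mem_vspan; exists u, v. Qed.

Lemma tens_space_ind U V (A : {vspace U}) (B : {vspace V})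
    (Q : tensor k U V -> Prop) :
  Q 0 -> (forall c s t, Q s -> Q t -> Q (c *: s + t)) ->
  (forall u v, u \in A -> v \in B -> Q (tens u v)) ->
  forall t, t \in tens_space A B -> Q t.
Proof.
move=> Q0 Qlin QAB; apply: vspan_ind => // _ [u [v [uA vB ->]]].
exact: QAB.
Qed.

Section Algebra.
Variable A : falgType k.
Implicit Types (u v : A) (s t : tensor k A A).

Lemma tens_mul_tens u v u' v' :
  tens_mul (tens u v) (tens u' v') = tens (u * u') (v * v').
Proof.
have in_bil (w z : A) : forall u v,
    tlift (fun u' v' => tens (w * u') (z * v')) (tens u v)
      = tens (w * u) (z * v).
  apply: tlift_tens => [y c s t | y c s t]; last first.
    by rewrite mulrDr -scalerAr linearP.
  by rewrite mulrDr -scalerAr tens_linl.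
rewrite /tens_mul tlift_tens ?in_bil // => w c y z; rewrite !in_bil.
  by rewrite mulrDl -scalerAl tens_linl.
by rewrite mulrDl -scalerAl linearP.
Qed.

Lemma tens_mul_linl t : linear (fun s => tens_mul s t).
Proof. by move=> c s s'; rewrite /tens_mul linearP. Qed.

Lemma tens_mul_linr s : linear (tens_mul s).
Proof. by move=> c t t'; apply: tlift_linfun => u v; rewrite linearP. Qed.

HB.instance Definition _ s :=
  GRing.isLinear.Build k (tensor k A A) (tensor k A A) _ (tens_mul s)
    (tens_mul_linr s).

Lemma tens_mulDl s s' t : tens_mul (s + s') t = tens_mul s t + tens_mul s' t.
Proof. by have := tens_mul_linl t 1 s s'; rewrite !scale1r. Qed.

End Algebra.

Section Slices.
Variables U V : vectType k.
Implicit Types (u : U) (v : V) (t : tensor k U V).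

(** [lslice l] is l (x) id and [rslice l] is id (x) l, with k (x) V and U (x) k
    identified with V and U. *)
Definition lslice (l : 'Hom(U, k^o)) t : V :=
  tlift (fun u v => (l u : k) *: v) t.
Definition rslice (l : 'Hom(V, k^o)) t : U :=
  tlift (fun u v => (l v : k) *: u) t.

HB.instance Definition _ l := GRing.Linear.copy (lslice l) (tlift _).
HB.instance Definition _ l := GRing.Linear.copy (rslice l) (tlift _).

Lemma lslice_tens l u v : lslice l (tens u v) = (l u : k) *: v.
Proof.
apply: tlift_tens => [w c y z | w c y z].
  by rewrite linearP scalerDl -scalerA.
by rewrite scalerDr !scalerA mulrC.
Qed.

Lemma rslice_tens l u v : rslice l (tens u v) = (l v : k) *: u.
Proof.
apply: tlift_tens => [w c y z | w c y z].
  by rewrite scalerDr !scalerA mulrC.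
by rewrite linearP scalerDl -scalerA.
Qed.

End Slices.

End TensorCalculus.

(** * Grouplike and skew primitive elements *)

Section Grouplikes.
Variables (k : fieldType) (H : hopfAlgebra k).
Implicit Types (g h u v : H) (l : 'Hom(H, k^o)).

Lemma grouplike1 : grouplike (1 : H).
Proof. by split; [exact: comul1 | exact: counit1]. Qed.

Lemma grouplikeM g h : grouplike g -> grouplike h -> grouplike (g * h).
Proof.
by case=> Dg eg [Dh eh]; split; rewrite ?comulM ?counitM ?Dg ?Dh ?tens_mul_tens
  ?eg ?eh ?mulr1.
Qed.

Lemma grouplikeX g n : grouplike g -> grouplike (g ^+ n).
Proof.
move=> gg; elim: n => [|n IHn]; first by rewrite expr0; exact: grouplike1.
by rewrite exprS; exact: grouplikeM.
Qed.

Lemma tlift_bilin (f g : 'End(H)) u v :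
  tlift (fun u v => f u * g v) (tens u v) = f u * g v.
Proof.
apply: tlift_tens => [w c y z|w c y z]; rewrite linearP.
  by rewrite mulrDl -scalerAl.
by rewrite mulrDr -scalerAr.
Qed.

(** For a grouplike element the antipode axioms say that S(g) is the inverse. *)
Lemma grouplike_unit g : grouplike g -> g \is a GRing.unit.
Proof.
case=> Dg eg; apply/unitrP; exists (antipode H g).
have := antipodel g; have := antipoder g; rewrite Dg eg scale1r.
have := tlift_bilin \1%VF (antipode H) g g.
have := tlift_bilin (antipode H) \1%VF g g.
rewrite !id_lfunE.
under eq_tlift do rewrite id_lfunE.
move=> ->.
under eq_tlift do rewrite id_lfunE.
by move=> -> -> ->.
Qed.

Lemma antipode_grouplike g : grouplike g -> antipode H g = g^-1.
Proof.
move=> gg; have gU := grouplike_unit gg; case: gg => Dg eg.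
apply: (mulIr gU); rewrite mulVr //.
have := antipodel g; rewrite Dg eg scale1r => <-.
have := tlift_bilin (antipode H) \1%VF g g.
by under eq_tlift do rewrite id_lfunE; rewrite id_lfunE => ->.
Qed.

Lemma grouplikeV g : grouplike g -> grouplike g^-1.
Proof.
move=> gg; have gU := grouplike_unit gg; case: gg => Dg eg; split.
  have mulK : forall t, tens_mul (tens g^-1 g^-1) (tens_mul (tens g g) t) = t.
    apply: tensor_ext => [c s t|//|u v]; first by rewrite !linearP.
    by rewrite !tens_mul_tens !mulKr.
  by rewrite -[LHS]mulK -Dg -comulM divrr // comul1 tens_mul_tens !mulr1.
by have := counitM g g^-1; rewrite divrr // eg counit1 mul1r => ->.
Qed.

Lemma grouplike_neq0 g : grouplike g -> g != 0.
Proof. by move/grouplike_unit; apply: contraTneq => ->; rewrite unitr0. Qed.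

(** The two actions of the dual of H on H: l applied to the left, respectively
    the right, tensor factor of the comultiplication. *)
Definition rhit l u : H := lslice l (comul H u).
Definition lhit l u : H := rslice l (comul H u).

Fact rhit_is_linear l : linear (rhit l).
Proof. by move=> c u v; rewrite /rhit !linearP. Qed.
Fact lhit_is_linear l : linear (lhit l).
Proof. by move=> c u v; rewrite /lhit !linearP. Qed.

HB.instance Definition _ l :=
  GRing.isLinear.Build k H H _ (rhit l) (rhit_is_linear l).
HB.instance Definition _ l :=
  GRing.isLinear.Build k H H _ (lhit l) (lhit_is_linear l).

Lemma rhit_counit u : rhit (counit H) u = u.
Proof. exact: counitl. Qed.

Lemma rhit_grouplike l g : grouplike g -> rhit l g = (l g : k) *: g.
Proof. by case=> Dg _; rewrite /rhit Dg lslice_tens. Qed.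

Lemma lhit_grouplike l g : grouplike g -> lhit l g = (l g : k) *: g.
Proof. by case=> Dg _; rewrite /lhit Dg rslice_tens. Qed.

Lemma rhit_skew l g h u :
  skew_primitive g h u -> rhit l u = (l u : k) *: g + (l h : k) *: u.
Proof. by rewrite /rhit => ->; rewrite linearD /= !lslice_tens. Qed.

Lemma lhit_skew l g h u :
  skew_primitive g h u -> lhit l u = (l g : k) *: u + (l u : k) *: h.
Proof. by rewrite /lhit => ->; rewrite linearD /= !rslice_tens. Qed.

(** The line of a grouplike element is a simple subcoalgebra. *)
Lemma grouplike_coradical g : grouplike g -> g \in coradical H.
Proof.
move=> gg; have g0 := grouplike_neq0 gg; case: gg => Dg _.
apply: mem_vspan; exists <[g]>%VS; last exact: memv_line.
split=> [||D _ Dg_sub].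
- by rewrite /subcoalgebra limg_line -memvE Dg mem_tens_space ?memv_line.
- by rewrite -dimv_eq0 dim_vline g0.
have := dimvS Dg_sub; rewrite dim_vline g0 leq_eqVlt ltnS leqn0 dimv_eq0.
case/orP=> [dD|/eqP]; [right | by left].
by apply/eqP; rewrite eqEdim Dg_sub dim_vline g0 (eqP dD).
Qed.

Lemma one_in_coradical : 1 \in coradical H.
Proof. exact/grouplike_coradical/grouplike1. Qed.

(** Linear independence of grouplikes in the form of dual functionals.  Among
    the subspaces D without g such that Delta(D) is contained in D (x) H, take a
    maximal one.  It contains every other grouplike h: if g = w + c h with w in
    D and h not in D, a form that vanishes on D and is 1 at h turns Delta(g)
    into c g = c h, so c = 0 and g is in D. *)
Lemma grouplike_dual g : grouplike g ->
  exists2 l : 'Hom(H, k^o), l g = 1 &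
    forall h, grouplike h -> h != g -> l h = 0.
Proof.
move=> gg.
pose good (D : {vspace H}) := g \notin D /\
  forall l, (forall u, u \in D -> l u = 0) ->
    forall u, u \in D -> rhit l u = 0.
have [|D [gD Dcoideal] maxD] := @max_subspace _ _ good 0%VS.
  split=> [|l _ u]; rewrite memv0 ?grouplike_neq0 // => /eqP->.
  by rewrite linear0.
have [l lg lD] := functional_separation gD; exists l => // h gh hg.
apply/lD/maxD; split=> [|l' l'Dh _ /memv_addP[w wD [_ /vlineP[c ->] ->]]].
  apply/negP => /memv_addP[w wD [_ /vlineP[c ->] gE]].
  have [hD|hD] := boolP (h \in D).
    by case/negP: gD; rewrite gE memvD // memvZ.
  have [l' l'h l'D] := functional_separation hD.
  have l'g : l' g = c.
    by rewrite gE linearD linearZ /= l'D // add0r l'h [c *: 1]mulr1.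
  have : rhit l' g = rhit l' (w + c *: h) by rewrite {1}gE.
  rewrite linearD linearZ /= (Dcoideal _ l'D _ wD) add0r.
  rewrite !rhit_grouplike // l'h scale1r l'g => /eqP.
  rewrite -subr_eq0 -scalerBr scaler_eq0.
  rewrite subr_eq0 [g == h]eq_sym (negPf hg) orbF => /eqP c0.
  by case/negP: gD; rewrite gE c0 scale0r addr0.
have l'D u : u \in D -> l' u = 0.
  by move=> uD; apply: l'Dh; rewrite -[u]addr0 memv_add ?mem0v.
rewrite linearD linearZ /= (Dcoideal _ l'D _ wD) rhit_grouplike // l'Dh.
  by rewrite scale0r scaler0 addr0.
by rewrite memvE addvSr.
Qed.

Section Pointed.
Hypothesis H_pointed : pointed H.

(** H_0 is spanned by the grouplikes: on a line that is a subcoalgebra,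
    Delta(c) = lam c (x) c, and the counit axiom makes lam c grouplike. *)
Lemma pointed_ind (Q : H -> Prop) :
  Q 0 -> (forall c u v, Q u -> Q v -> Q (c *: u + v)) ->
  (forall g, grouplike g -> Q g) -> forall u, u \in coradical H -> Q u.
Proof.
move=> Q0 Qlin Qg; apply: vspan_ind => // x [C Csimple xC].
have dC := H_pointed Csimple; case: Csimple => Ccoalg C0 _.
pose c := vpick C; have c0 : c != 0 by rewrite vpick0.
have CE : C = <[c]>%VS.
  by apply/eqP; rewrite eq_sym eqEdim -memvE memv_pick dim_vline c0 dC.
have [lam Dc] : exists lam, comul H c = lam *: tens c c.
  apply/vlineP; have: comul H c \in tens_space C C.
    by apply: (subvP Ccoalg); rewrite memv_img // memv_pick.
  move: (comul H c); apply: tens_space_ind => [|d s t sT tT|u v].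
  - exact: mem0v.
  - by rewrite memvD // memvZ.
  rewrite CE => /vlineP[d ->] /vlineP[e ->].
  by rewrite tensZl tensZr !memvZ // memv_line.
have lamE : lam * counit H c = 1.
  have cE : lam *: ((counit H c : k) *: c) = c.
    by move: (rhit_counit c); rewrite /rhit Dc linearZ /= lslice_tens.
  have : (lam * counit H c - 1) *: c == 0.
    by rewrite scalerBl scale1r -scalerA cE subrr.
  by rewrite scaler_eq0 (negPf c0) orbF subr_eq0 => /eqP.
have gg : grouplike (lam *: c).
  split; last by rewrite linearZ.
  by rewrite linearZ /= Dc tensZl tensZr.
have lam0 : lam != 0.
  by apply: contra_eq_neq lamE => ->; rewrite mul0r eq_sym oner_eq0.
move: xC; rewrite CE => /vlineP[d ->].
rewrite -[d *: c]addr0 -[c](scalerK lam0) scalerA; apply: Qlin => //.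
exact: Qg.
Qed.

Lemma coradicalM u v :
  u \in coradical H -> v \in coradical H -> u * v \in coradical H.
Proof.
move=> uH vH; move: u uH; apply: pointed_ind => [|c u w uH wH|g gg].
- by rewrite mul0r mem0v.
- by rewrite mulrDl -scalerAl memvD // memvZ.
move: v vH; apply: pointed_ind => [|c v w vH wH|h gh].
- by rewrite mulr0 mem0v.
- by rewrite mulrDr -scalerAr memvD // memvZ.
by apply/grouplike_coradical/grouplikeM.
Qed.

(** On H_0 the functional dual to g acts as the projection onto the line of
    g. *)
Lemma hit_coradical l g :
  l g = 1 -> (forall h, grouplike h -> h != g -> l h = 0) ->
  forall u, u \in coradical H ->
    rhit l u = (l u : k) *: g /\ lhit l u = (l u : k) *: g.
Proof.
move=> lg lh; apply: pointed_ind => [|c u v [Lu Ru] [Lv Rv]|h gh].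
- by rewrite !linear0 scale0r.
- by rewrite !linearP /= Lu Ru Lv Rv scalerDl scalerA.
rewrite rhit_grouplike // lhit_grouplike //.
by have [-> //|hg] := eqVneq h g; rewrite (lh _ gh hg) !scale0r.
Qed.

(** Compare the two expressions for the action on y of the functional dual
    to 1: it is a multiple of 1 because y is in H_0, and a multiple of b plus y
    because y is skew primitive. *)
Lemma skew_primitive_coradical b y :
  skew_primitive b 1 y -> y \in coradical H ->
  exists c : k, y = c *: (b - 1).
Proof.
move=> Dy yH; have [l l1 lh] := grouplike_dual grouplike1.
exists (- l y); have [+ _] := hit_coradical l1 lh yH.
rewrite (rhit_skew _ Dy) l1 scale1r => yE.
by rewrite scaleNr -scalerN opprB scalerBr -yE addrC addKr.
Qed.

(** The functional dual to b kills a and so isolates d *: y, modulo multiples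
    of 1 and b. *)
Lemma skew_primitive_indep a b x y c d : grouplike a -> grouplike b -> a != b ->
  skew_primitive a 1 x -> skew_primitive b 1 y ->
  c *: x + d *: y \in coradical H -> d *: y \in coradical H.
Proof.
move=> ga gb ab Dx Dy zH; have [l lb lh] := grouplike_dual gb.
have [_] := hit_coradical lb lh zH.
rewrite linearD !linearZ /= (lhit_skew _ Dx) (lhit_skew _ Dy) lh // lb.
rewrite scale0r add0r scale1r scalerDr addrCA.
move/(canRL (addrK _)) => ->.
by rewrite memvB ?memvD ?memvZ ?grouplike_coradical //; apply: grouplike1.
Qed.

End Pointed.

End Grouplikes.

(** * Rank one allows only one skew point *)

Section RankOne.
Variables (k : fieldType) (H : hopfAlgebra k).
Implicit Types (a b g h u v x y : H).

Lemma skew_primitive_coradical1 g h u : grouplike g -> grouplike h ->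
  skew_primitive g h u -> u \in coradical1 H.
Proof.
move=> gg gh Du; rewrite -memv_preim Du.
by rewrite memv_add ?mem_tens_space ?memvf ?grouplike_coradical.
Qed.

Lemma grouplike_coradical1 g : grouplike g -> g \in coradical1 H.
Proof.
move=> gg; rewrite -memv_preim gg.1 -[tens g g]addr0.
by rewrite memv_add ?mem0v ?mem_tens_space ?memvf ?grouplike_coradical.
Qed.

(** Apply the counit to the left factor of Delta(u) = u (x) a + 1 (x) u. *)
Lemma counit_skew a u : grouplike a -> skew_primitive a 1 u -> counit H u = 0.
Proof.
move=> ga Du; have := rhit_skew (counit H) Du.
rewrite rhit_counit counit1 scale1r -{1}[u]add0r => /addIr/esym/eqP.
by rewrite scaler_eq0 (negPf (grouplike_neq0 ga)) orbF => /eqP.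
Qed.

(** H_1 / H_0 is a left Hopf module over H_0, with coaction m |-> m_{-1} (x) m_0
    induced by Delta, and m |-> S(m_{-1}) m_0 projects it onto its coinvariants.
    The choice of a linear projection of H onto H_0 makes this formula a map
    defined on all of H; modulo H_0 its values on H_1 do not depend on that
    choice. *)
Definition coinvariant_tens (t : tensor k H H) : H :=
  tlift (fun u v => antipode H (projv (coradical H) u) * v) t.

HB.instance Definition _ := GRing.Linear.copy coinvariant_tens (tlift _).

Lemma coinvariant_tensE u v :
  coinvariant_tens (tens u v) = antipode H (projv (coradical H) u) * v.
Proof.
apply: tlift_tens => [w c y z|w c y z]; rewrite ?linearP /=.
  by rewrite mulrDl -scalerAl.
by rewrite mulrDr -scalerAr.
Qed.

Definition coinvariant_part u : H := coinvariant_tens (comul H u).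

Fact coinvariant_part_linear : linear coinvariant_part.
Proof. by move=> c u v; rewrite /coinvariant_part !linearP. Qed.

HB.instance Definition _ :=
  GRing.isLinear.Build k H H _ coinvariant_part coinvariant_part_linear.

Hypothesis H_pointed : pointed H.

Lemma antipode_coradical u : u \in coradical H -> antipode H u \in coradical H.
Proof.
move: u; apply: (pointed_ind H_pointed) => [|c u v uH vH|g gg].
- by rewrite linear0 mem0v.
- by rewrite linearP memvD // memvZ.
by rewrite antipode_grouplike //; apply/grouplike_coradical/grouplikeV.
Qed.

Lemma coinvariant_tens_coradical t :
  t \in tens_space fullv (coradical H) -> coinvariant_tens t \in coradical H.
Proof.
move: t; apply: tens_space_ind => [|c s t sH tH|u v _ vH].
- by rewrite linear0 mem0v.
- by rewrite linearP memvD // memvZ.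
rewrite coinvariant_tensE; apply: (coradicalM H_pointed) => //.
by rewrite antipode_coradical // memv_proj.
Qed.

Lemma coinvariant_part_skew a u : grouplike a -> skew_primitive a 1 u ->
  coinvariant_part u - u \in coradical H.
Proof.
move=> ga Du; rewrite /coinvariant_part Du linearD /= !coinvariant_tensE.
rewrite [projv _ 1]projv_id; last exact: one_in_coradical.
rewrite (antipode_grouplike (grouplike1 H)) invr1 mul1r addrK.
apply: (coradicalM H_pointed _ (grouplike_coradical ga)).
by rewrite antipode_coradical ?memv_proj.
Qed.

(** Write t = r + s with s in H_0 (x) H.  The summand r in H (x) H_0 only
    contributes to H_0, and for a grouplike u the group law gives
    S(h u) h v = S(u) v. *)
Lemma coinvariant_tens_translate h t : grouplike h ->
  t \in (tens_space fullv (coradical H) + tens_space (coradical H) fullv)%VS ->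
  coinvariant_tens (tens_mul (tens h h) t) - coinvariant_tens t
    \in coradical H.
Proof.
move=> gh /memv_addP[r rH [s sH0 ->]].
have hr : tens_mul (tens h h) r \in tens_space fullv (coradical H).
  move: r rH; apply: tens_space_ind => [|c r r' rH rH'|u v _ vH].
  - by rewrite linear0 mem0v.
  - by rewrite linearP memvD // memvZ.
  rewrite tens_mul_tens mem_tens_space ?memvf //.
  exact: (coradicalM H_pointed (grouplike_coradical gh) vH).
have hs : coinvariant_tens (tens_mul (tens h h) s) = coinvariant_tens s.
  move: s sH0; apply: tens_space_ind => [|c s s' sE sE'|u v uH _].
  - by rewrite !linear0.
  - by rewrite !linearP /= sE sE'.
  rewrite tens_mul_tens !coinvariant_tensE !projv_id //; last first.
    exact: (coradicalM H_pointed (grouplike_coradical gh) uH).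
  move: u uH; apply: (pointed_ind H_pointed) => [|c u u' uE uE'|g gg].
  - by rewrite mulr0 !linear0 !mul0r.
  - by rewrite mulrDr -scalerAr !linearP /= !mulrDl -!scalerAl uE uE'.
  have [hU gU] := (grouplike_unit gh, grouplike_unit gg).
  rewrite (antipode_grouplike gg) (antipode_grouplike (grouplikeM gh gg)).
  by rewrite invrM // mulrA divrK.
rewrite !linearD /= hs addrACA subrr addr0.
by rewrite memvB // coinvariant_tens_coradical.
Qed.

(** The coinvariant projection kills H_0^+ H_1 modulo H_0. *)
Lemma coinvariant_part_translate h u :
  h \in coradical H -> u \in coradical1 H ->
  coinvariant_part (h * u) - (counit H h : k) *: coinvariant_part u
    \in coradical H.
Proof.
move=> + uH; move: h; apply: (pointed_ind H_pointed) => [|c h h' hE hE'|h gh].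
- by rewrite mul0r !linear0 scale0r subrr mem0v.
- rewrite mulrDl -scalerAl !linearP /= scalerDl -scalerA opprD addrACA.
  by rewrite -scalerBr memvD // memvZ.
have [Dh eh] := gh; rewrite eh scale1r /coinvariant_part comulM Dh.
by apply: coinvariant_tens_translate; rewrite // memv_preim.
Qed.

(** The left unit isomorphism from k (x) H to H. *)
Definition tens_unitl (t : tensor k k^o H) : H :=
  tlift (fun (c : k^o) u => (c : k) *: u) t.
HB.instance Definition _ := GRing.Linear.copy tens_unitl (tlift _).

Lemma tens_unitl_tens (c : k^o) u : tens_unitl (tens c u) = (c : k) *: u.
Proof.
apply: tlift_tens => [w d y z|w d y z].
  by rewrite scalerDl scalerA.
by rewrite scalerDr !scalerA mulrC.
Qed.

(** The two tests that detect independence modulo the balancing relations: the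
    counit sees the class of 1, and the coinvariant projection modulo H_0 sees
    the classes of skew primitive elements. *)
Lemma balancing_coinvariant t : t \in balancing H ->
  counit H (tens_unitl t) = 0 /\
  coinvariant_part (tens_unitl t) \in coradical H.
Proof.
move: t; apply: vspan_ind => [|c s t [es sH] [et tH]|_ [c [h [u [hH uH ->]]]]].
- by rewrite !linear0 mem0v.
- by rewrite !linearP /= es et scaler0 addr0 memvD // memvZ.
rewrite linearB /= !tens_unitl_tens; split.
  rewrite linearB !linearZ /= counitM -scalerA -scalerDr.
  by rewrite (_ : _ - _ = 0) ?scaler0 //; exact: subrr.
rewrite -scalerA -scalerBr linearZ /= memvZ // -opprB linearN memvN.
by rewrite linearB linearZ /= coinvariant_part_translate.
Qed.

(** If y were not in H_0, the classes of 1, x and y in k (x)_{H_0} H_1 would be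
    independent, so that the dimension would be at least 3. *)
Lemma rank_one_skew_point a b x y : has_rank H 1 ->
  grouplike a -> grouplike b -> a != b ->
  skew_primitive a 1 x -> skew_primitive b 1 y ->
  x \notin coradical H -> y \in coradical H.
Proof.
move=> rk ga gb ab Dx Dy xH; apply/negPn/negP => yH.
have g1 := grouplike1 H.
have xy_indep c d : c *: x + d *: y \in coradical H -> c = 0 /\ d = 0.
  move=> zH; have yH' := skew_primitive_indep H_pointed ga gb ab Dx Dy zH.
  move: zH; rewrite rpredDr // !rpredZeq (negPf xH) orbF => /eqP->.
  by move: yH'; rewrite rpredZeq (negPf yH) orbF => /eqP->.
have [ex ey] := (counit_skew ga Dx, counit_skew gb Dy).
have tens1 u : u \in coradical1 H ->
    tens (1 : k^o) u \in tens_space fullv (coradical1 H).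
  by move=> uH; rewrite mem_tens_space ?memvf.
have : (3 <= \dim (tens_space fullv (coradical1 H) :\: balancing H))%N.
  apply: (dim_diffv_ge (X := [tuple tens (1 : k^o) 1; tens (1 : k^o) x;
                                   tens (1 : k^o) y])) => [|c].
    case; case=> [|[|[|//]]] /= _; apply: tens1.
    - exact: grouplike_coradical1.
    - exact: skew_primitive_coradical1 Dx.
    - exact: skew_primitive_coradical1 Dy.
  rewrite !big_ord_recl big_ord0 /= addr0 => /balancing_coinvariant.
  rewrite !linearD !linearZ /= !tens_unitl_tens !scale1r.
  rewrite ex ey counit1 !scaler0 !addr0 [_ *: 1]mulr1 => -[c0].
  rewrite c0 scale0r add0r; set c1 := c _; set c2 := c _ => cH.
  have [c1_0 c2_0] : c1 = 0 /\ c2 = 0.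
    (* Modulo H_0, x and y agree with their coinvariant parts. *)
    apply: xy_indep; rewrite -[x](subKr (coinvariant_part x)).
    rewrite -[y in _ + _ *: y](subKr (coinvariant_part y)) !scalerBr addrACA.
    rewrite -opprD; apply: (memvB cH); apply: memvD;
      rewrite -scalerBr; apply: memvZ.
      exact: coinvariant_part_skew ga Dx.
    exact: coinvariant_part_skew gb Dy.
  case; case=> [|[|[|//]]] /= i3.
  - by rewrite -c0; congr c; apply: val_inj.
  - by rewrite -c1_0; congr c; apply: val_inj.
  - by rewrite -c2_0; congr c; apply: val_inj.
by rewrite rk.
Qed.

End RankOne.

(** * Falling factorials *)

Definition falling (R : pzRingType) (x : R) n : R := \prod_(i < n) (x - i%:R).

Lemma falling0 (R : pzRingType) (x : R) : falling x 0 = 1.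
Proof. exact: big_ord0. Qed.

Lemma fallingSl (R : pzRingType) (x : R) n :
  falling x n.+1 = (x - n%:R) * falling x n.
Proof.
rewrite {1}/falling big_ord_recr /=; apply/commr_sym/commr_prod => i _.
apply: commrB; last exact: commr_nat.
by apply/commr_sym/commrB => //; apply: commr_nat.
Qed.

(** Both sides are monic of degree p, and by Fermat the p distinct elements of
    the prime field are roots of the right-hand side. *)
Lemma prod_pchar (k : fieldType) p : p \in [pchar k] ->
  \prod_(i < p) ('X - (i%:R : k)%:P) = 'X^p - 'X.
Proof.
move=> kp; have p_pr := pcharf_prime kp.
have sp : size ('X^p - 'X : {poly k}) = p.+1.
  by rewrite size_polyDl size_polyXn // size_polyN size_polyX ltnS prime_gt1.
pose rs : seq k := [seq i%:R | i <- iota 0 p].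
rewrite [RHS](@all_roots_prod_XsubC _ _ rs).
- rewrite lead_coefE sp coefB coefXn coefX eqxx /= gtn_eqF ?prime_gt1 //.
  by rewrite subr0 scale1r big_map -[p in iota _ p]subn0 big_mkord.
- by rewrite sp size_map size_iota.
- apply/allP => _ /mapP[i _ ->]; rewrite rootE !hornerE.
  by rewrite -(pFrobenius_autE kp) pFrobenius_aut_nat subrr.
rewrite uniq_rootsE map_inj_in_uniq ?iota_uniq // => i j.
rewrite !mem_iota !add0n /= => ip jp; wlog ij : i j ip jp / (i <= j)%N.
  move=> IH /[dup] /esym ijE jiE; case/orP: (leq_total i j) => [ij|ji].
    exact: IH.
  exact/esym/IH.
move=> /esym/eqP; rewrite -subr_eq0 -natrB // -(dvdn_pcharf kp) => dvd_p.
apply/eqP; rewrite eqn_leq ij -subn_eq0 -leqn0 leqNgt /=; apply/negP => ji.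
have := leq_trans (dvdn_leq ji dvd_p) (leq_subr i j).
by rewrite leqNgt jp.
Qed.

Lemma falling_pchar (k : fieldType) (A : algType k) p (x : A) :
  p \in [pchar k] -> falling x p = x ^+ p - x.
Proof.
move=> kp; have := congr1 (horner_alg x) (prod_pchar kp).
rewrite rmorphB rmorphXn /= horner_algX => <-; rewrite rmorph_prod /=.
apply: eq_bigr => i _; rewrite rmorphB /= horner_algX horner_algC.
by rewrite scaler_nat.
Qed.

Lemma sum_pascal (V : nmodType) (T : nat -> V) n :
  \sum_(j < n.+1) (T j.+1 + T j) *+ 'C(n, j) =
  \sum_(j < n.+2) T j *+ 'C(n.+1, j).
Proof.
rewrite [RHS]big_ord_recl /= bin0 mulr1n.
under [X in _ = _ + X]eq_bigr do rewrite /bump /= add1n binS mulrnDr.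
under eq_bigr do rewrite mulrnDl.
rewrite !big_split /= [X in _ = _ + (X + _)]big_ord_recr /= bin_small // addr0.
rewrite addrA [LHS]addrC; congr (_ + _).
by rewrite big_ord_recl /= bin0 mulr1n.
Qed.

(** * Hopf algebras of third type *)

Section ThirdType.
Variables (k : fieldType) (H : hopfAlgebra k) (a x : H).
Hypotheses (ga : grouplike a) (Dx : skew_primitive a 1 x).
Hypothesis xaE : x * a = a * x + (a - a ^+ 2).

(** Commutation with x acts on the powers of a as the derivation
    (a - a^2) d/da. *)
Lemma third_type_exp j : x * a ^+ j = a ^+ j * x + (a ^+ j - a ^+ j.+1) *+ j.
Proof.
elim: j => [|j IHj]; first by rewrite expr0 mulr1 mul1r mulr0n addr0.
rewrite exprSr mulrA IHj mulrDl -mulrA xaE mulrDr mulrA -exprSr -addrA.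
congr (_ + _); rewrite mulrBr -exprSr -exprD addn2 mulrSr addrC; congr (_ + _).
by rewrite mulrnAl mulrBl -!exprSr.
Qed.

(** Multiply by Delta(x) - n = x (x) a + 1 (x) (x - n) on the left.  Moving x - n
    past a^j turns it into x - (n-j), which raises the second factorial, at the
    price of a term - j a^(j+1); this term corrects the x of the first summand
    to x - j, which raises the first factorial.  What remains is the Pascal
    rule. *)
Lemma comul_falling n : comul H (falling x n) =
  \sum_(j < n.+1) tens (falling x j) (a ^+ j * falling x (n - j)) *+ 'C(n, j).
Proof.
elim: n => [|n IHn].
  by rewrite big_ord1 !falling0 expr0 mulr1 comul1 bin0.
pose T j := tens (falling x j) (a ^+ j * falling x (n.+1 - j)).
rewrite -(sum_pascal T) fallingSl comulM {}IHn linear_sum; apply: eq_bigr.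
move=> [j /= jn] _; have j_le : (j <= n)%N := jn.
rewrite linearMn /=; congr (_ *+ _).
have -> : comul H (x - n%:R) = tens x a + tens 1 (x - n%:R).
  rewrite linearB linearMn /= comul1 Dx -addrA; congr (_ + _).
  by rewrite [in RHS]linearB /= [tens 1 n%:R]linearMn.
have x_aX : (x - n%:R) * a ^+ j = a ^+ j * (x - (n - j)%:R) - a ^+ j.+1 *+ j.
  rewrite mulrBl third_type_exp mulrnBl mulr_natl mulrBr mulr_natr.
  rewrite -[in X in _ - X](subnK j_le) mulrnDr opprD addrACA; congr (_ + _).
  by rewrite addrAC subrr add0r.
rewrite tens_mulDl !tens_mul_tens mul1r !(mulrA _ (a ^+ j)) x_aX mulrBl.
rewrite -exprS -mulrA mulrnAl [tens _ (_ - _)]linearB /=.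
rewrite [tens _ (_ *+ _)]linearMn /= -fallingSl -subSn // /T subSS.
rewrite [in RHS]fallingSl mulrBl mulr_natl -[falling x j *+ j]scaler_nat.
by rewrite -scaleNr tensDl tensZl scaleNr scaler_nat addrA addrAC.
Qed.

(** Only the terms j = 0 and j = p survive in characteristic p. *)
Lemma skew_primitive_falling p : p \in [pchar k] ->
  skew_primitive (a ^+ p) 1 (falling x p).
Proof.
move=> kp; rewrite /skew_primitive comul_falling big_ord_recr /= subnn binn.
rewrite falling0 mulr1 mulr1n addrC; congr (_ + _).
case: p kp => [|p] kp; first by have := pcharf_prime kp.
rewrite big_ord_recl /= big1 ?addr0 => [|i _].
  by rewrite falling0 subn0 expr0 mul1r bin0.
rewrite /bump /= add1n -scaler_nat (bin_lt_pcharf_0 kp) ?scale0r //=.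
by rewrite ltnS.
Qed.

Lemma rhit_mulgrouplike (l : 'Hom(H, k^o)) (g u : H) : grouplike g ->
  rhit l (g * u) = g * rhit (l \o amull g)%VF u.
Proof.
move=> [Dg _]; rewrite /rhit comulM Dg; move: (comul H u).
apply: tensor_ext => [c s t|c s t|y z]; rewrite ?linearP //=.
  by rewrite mulrDr -scalerAr.
by rewrite tens_mul_tens !lslice_tens comp_lfunE lfunE /= scalerAr.
Qed.

Lemma rhit_mulskew (l : 'Hom(H, k^o)) u :
  rhit l (u * x) = rhit (l \o amulr x)%VF u * a + rhit l u * x.
Proof.
rewrite /rhit comulM Dx; move: (comul H u).
apply: tensor_ext => [c s t|c s t|y z].
- by rewrite tens_mul_linl linearP.
- by rewrite !linearP /= !mulrDl scalerDr addrACA -!scalerAl.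
rewrite linearD /= !tens_mul_tens linearD /= !lslice_tens mulr1.
by rewrite comp_lfunE lfunE /= !scalerAl.
Qed.

(** So that [reduces_at x n] reads: x^n is in [xspan n]. *)
Definition xspan n : {vspace H} := (\sum_(i < n) coradical H * <[x ^+ i]>)%VS.

Lemma xspan_sub n (W : {vspace H}) :
  (forall h i, h \in coradical H -> (i < n)%N -> h * x ^+ i \in W) ->
  (xspan n <= W)%VS.
Proof.
move=> hW; apply/subv_sumP => i _; apply/prodvP => h _ hH /vlineP[c ->].
by rewrite -scalerAr memvZ ?hW.
Qed.

Lemma mem_xspan_mul h i n :
  h \in coradical H -> (i < n)%N -> h * x ^+ i \in xspan n.
Proof.
move=> hH i_n; have := memv_mul hH (memv_line (x ^+ i)).
by apply: subvP; apply: (sumv_sup (Ordinal i_n)).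
Qed.

Lemma xspan_mono m n : (m <= n)%N -> (xspan m <= xspan n)%VS.
Proof.
move=> mn; apply: xspan_sub => h i hH im.
by rewrite mem_xspan_mul ?(leq_trans im).
Qed.

Lemma mem_xspan n : x ^+ n \in xspan n.+1.
Proof.
by have := mem_xspan_mul (one_in_coradical H) (ltnSn n); rewrite mul1r.
Qed.

Lemma xspan_mulr n u : u \in xspan n -> u * x \in xspan n.+1.
Proof.
have /subvP sub : (xspan n <= amulr x @^-1: xspan n.+1)%VS.
  apply: xspan_sub => h i hH i_n; rewrite -memv_preim lfunE /=.
  by rewrite -mulrA -exprSr mem_xspan_mul.
by move/sub; rewrite -memv_preim lfunE.
Qed.

Lemma xspan_mull n g u : pointed H ->
  grouplike g -> u \in xspan n -> g * u \in xspan n.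
Proof.
move=> H_pointed gg.
have /subvP sub : (xspan n <= amull g @^-1: xspan n)%VS.
  apply: xspan_sub => h i hH i_n; rewrite -memv_preim lfunE /= mulrA.
  apply: mem_xspan_mul => //.
  exact: (coradicalM H_pointed (grouplike_coradical gg) hH).
by move/sub; rewrite -memv_preim lfunE.
Qed.

(** Leading term of Delta(x^i): modulo xspan i in the left factor it is
    x^i (x) a^i. *)
Lemma rhit_expx i (l : 'Hom(H, k^o)) : (forall u, u \in xspan i -> l u = 0) ->
  rhit l (x ^+ i) = (l (x ^+ i) : k) *: a ^+ i.
Proof.
elim: i l => [|i IHi] l l0.
  by rewrite !expr0 rhit_grouplike //; apply: grouplike1.
have lS u : u \in xspan i -> l u = 0.
  by move=> /(subvP (xspan_mono (leqnSn i))); apply: l0.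
rewrite [x ^+ i.+1]exprSr rhit_mulskew IHi => [|u uS]; last first.
  by rewrite comp_lfunE lfunE /= l0 // xspan_mulr.
rewrite IHi // (l0 _ (mem_xspan i)) scale0r mul0r addr0.
by rewrite comp_lfunE lfunE /= -scalerAl [a ^+ i.+1]exprSr.
Qed.

(** Second term of Delta(x^(i+1)): in front of x^i in the left factor stands
    (i+1) a^i x modulo H_0, one summand a^i x for each position of the factor
    1 (x) x in the product of i+1 copies of Delta(x). *)
Lemma rhit_expx_next (H_pointed : pointed H) i (l : 'Hom(H, k^o)) :
  (forall u, u \in xspan i -> l u = 0) ->
  rhit l (x ^+ i.+1) - ((l (x ^+ i) : k) *: (a ^+ i * x)) *+ i.+1
    \in coradical H.
Proof.
have aH j : a ^+ j \in coradical H by apply/grouplike_coradical/grouplikeX.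
elim: i l => [|i IHi] l l0.
  rewrite expr1 expr0 mul1r mulr1n (rhit_skew _ Dx) addrK memvZ //.
  exact: (aH 1%N).
have lx0 u : u \in xspan i -> (l \o amulr x)%VF u = 0.
  by move=> uS; rewrite comp_lfunE lfunE /= l0 // xspan_mulr.
rewrite [x ^+ i.+2]exprSr rhit_mulskew (rhit_expx l0).
have := IHi _ lx0; rewrite comp_lfunE lfunE /= -exprSr.
set c := (l (x ^+ i.+1) : k); set w := rhit _ _ => wH.
have -> : w * a + c *: a ^+ i.+1 * x - c *: (a ^+ i.+1 * x) *+ i.+2 =
    (w - c *: (a ^+ i * x) *+ i.+1) * a + c *: (a ^+ i * (a - a ^+ 2)) *+ i.+1.
  rewrite -scalerAl [_ *+ i.+2]mulrS opprD [in LHS]addrA addrK.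
  rewrite [in RHS]mulrBl mulrnAl -scalerAl -[a ^+ i * x * a]mulrA xaE mulrDr.
  by rewrite scalerDr mulrnDl mulrA -exprSr opprD addrA addrNK.
apply: memvD; first exact: (coradicalM H_pointed wH (aH 1%N)).
rewrite rpredMn // memvZ // mulrBr -exprSr -exprD.
by apply: memvB; apply: aH.
Qed.

(** A relation of degree m+1 < p would put (m+1) a^m x in H_0, by the second
    term of Delta(x^(m+1)); since m+1 is invertible, x would be in H_0. *)
Lemma expx_notin_xspan (H_pointed : pointed H) (xH : x \notin coradical H) p :
  p \in [pchar k] -> forall m, (m < p)%N -> x ^+ m \notin xspan m.
Proof.
move=> kp; elim=> [|m IHm] m_p.
  by rewrite /xspan big_ord0 memv0 expr0 oner_eq0.
apply: contra xH => xS.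
have [l l1 l0] := functional_separation (IHm (ltnW m_p)).
have /subvP sub : (xspan m.+1 <= linfun (rhit l) @^-1: coradical H)%VS.
  apply: xspan_sub => h i + i_m; have {}i_m : (i <= m)%N := i_m; move: h.
  apply: (pointed_ind H_pointed) => [|c u v uH vH|g gg].
  - by rewrite mul0r mem0v.
  - by rewrite mulrDl -scalerAl memvD // memvZ.
  rewrite -memv_preim lfunE /= rhit_mulgrouplike // rhit_expx => [|u uS].
    rewrite -scalerAr memvZ //; apply/grouplike_coradical/grouplikeM => //.
    exact: grouplikeX.
  by rewrite comp_lfunE lfunE /= l0 // xspan_mull // (subvP (xspan_mono i_m)).
have := sub _ xS; rewrite -memv_preim lfunE /= => lH.
have := rhit_expx_next H_pointed l0; rewrite l1 scale1r => lH'.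
have axH : a ^+ m * x \in coradical H.
  have m0 : (m.+1%:R : k) != 0.
    by rewrite -(dvdn_pcharf kp) gtnNdvd.
  rewrite -[a ^+ m * x](scalerK m0) memvZ // scaler_nat.
  rewrite -[_ *+ _](subKr (rhit l (x ^+ m.+1))).
  exact: memvB.
have gam := grouplikeX m ga.
rewrite -[x](mulKr (grouplike_unit gam)).
exact: (coradicalM H_pointed (grouplike_coradical (grouplikeV gam)) axH).
Qed.

End ThirdType.

Theorem lemma4p12 (k : fieldType) (p : nat) (hp : p \in [pchar k])
    (H : hopfAlgebra k)
    (H_pointed : pointed H)
    (H_rank1 : has_rank H 1)
    (H_gen : generated_by_coradical1 H)
    (a : H) (a_skew : skew_point a)
    (H_third : third_type a)
    (x : H) (x_prim : skew_primitive a 1 x) (x_notin : x \notin coradical H)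
    (x_conj : a * x * a^-1 = x + (a - 1)) :
  [/\ x ^+ p \in coradical1 H,
      is_degree x p &
      exists alpha : k, x ^+ p = x + alpha *: (a ^+ p - 1)].
Proof.
have [ga _] := a_skew; have aU := grouplike_unit ga.
have p_pr := pcharf_prime hp.
have xaE : x * a = a * x + (a - a ^+ 2).
  have /(congr1 ( *%R^~ a)) := x_conj; rewrite divrK // => ->.
  by rewrite mulrDl mulrBl mul1r -expr2 -(opprB (a ^+ 2)) addrK.
have gap := grouplikeX p ga.
(* a^p commutes with x, and a does not since a <> a^2. *)
have a_neq : a != a ^+ p.
  apply/eqP => aE; have := third_type_exp xaE p.
  have Hp : p \in [pchar H] by rewrite pchar_lalg.
  rewrite -aE (mulrn_pchar Hp) addr0 xaE => /(canRL (addKr _)).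
  rewrite addNr => /eqP; rewrite subr_eq0 => /eqP a2.
  case/eqP: H_third.1; apply: (mulIr aU).
  by rewrite mul1r -expr2 -a2.
have Dy := skew_primitive_falling x_prim xaE hp.
have yH := rank_one_skew_point H_pointed H_rank1 ga gap a_neq x_prim Dy x_notin.
have [alpha yE] := skew_primitive_coradical H_pointed Dy yH.
have xpE : x ^+ p = x + alpha *: (a ^+ p - 1).
  by rewrite -yE (falling_pchar x hp) addrC subrK.
have xp_red : reduces_at x p.
  rewrite /reduces_at -/(xspan x p) xpE memvD //.
    apply: (subvP (xspan_mono x (prime_gt1 p_pr))).
    by have := mem_xspan x 1; rewrite expr1.
  rewrite memvZ // -[_ - _]mulr1 -(expr0 x); apply: mem_xspan_mul.
    by rewrite memvB ?one_in_coradical ?grouplike_coradical.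
  exact: prime_gt0.
split; last by exists alpha.
  rewrite xpE memvD //.
    exact: (skew_primitive_coradical1 ga (grouplike1 H) x_prim).
  by apply/memvZ/memvB; apply: grouplike_coradical1 => //; apply: grouplike1.
split=> // m m_red; rewrite leqNgt; apply/negP => m_p.
by have /negP := expx_notin_xspan ga x_prim xaE H_pointed x_notin hp m_p; apply.
Qed.
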